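(* Let $(\boldsymbol{q}^*,\boldsymbol{z}^*,\boldsymbol{x}^* )$ be an optimal solution of the A-IPR-P problem $$\min_{\boldsymbol{x}\in\mathcal{X},\ \boldsymbol{q}\in\mathcal{D}(\boldsymbol{x}),\ \boldsymbol{z}\in\mathcal{Z}(\boldsymbol{q})}\ -\Psi\sum_{p\in\mathcal{P}}\sum_{r\in\mathcal{R}_p}x_{p,r}V_p^r+WT(\boldsymbol{q},\boldsymbol{z})+IVT(\boldsymbol{q},\boldsymbol{z}),$$ and let $\boldsymbol{Q}(\boldsymbol{x}^* )$ be the random vector of path flows under $\boldsymbol{x}^*$, with support $\mathcal{Q}(\boldsymbol{x}^* )$. Suppose that - for the linear program defining $STT$, the set of optimal flows is bounded, and $STT$ is Lipschitz with constant $L$: $|STT(\boldsymbol{q}_1)-STT(\boldsymbol{q}_2)|\le L\,\|\boldsymbol{q}_1-\boldsymbol{q}_2\|_1$ for any network flows $\boldsymbol{q}_1,\boldsymbol{q}_2$; - the network flows are bounded from above: there exists $\boldsymbol{q}^{\mathrm{Max}}<\infty$ such that $\hat{\boldsymbol{q}}\le\boldsymbol{q}^{\mathrm{Max}}$ for all $\hat{\boldsymbol{q}}\in\mathcal{Q}(\boldsymbol{x}^* )$; - $|\boldsymbol{q}^*-\mathbb{E}[\boldsymbol{Q}(\boldsymbol{x}^* )]|\le\boldsymbol{\epsilon}$ and $\mathrm{Var}[\boldsymbol{Q}(\boldsymbol{x}^* )]\le\boldsymbol{\Gamma}^2$ (componentwise). Then the difference between the model-evaluated system travel time $STT(\boldsymbol{q}^*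 )$ and the expected system travel time is bounded from above: $$\left|\mathbb{E}_{\boldsymbol{Q}(\boldsymbol{x}^* )}[STT(\boldsymbol{Q}(\boldsymbol{x}^* ))]-STT(\boldsymbol{q}^* )\right|\le 2L\|\boldsymbol{\epsilon}\|_1+L\left(\|\mathbb{E}[\boldsymbol{Q}(\boldsymbol{x}^* )]\|_1+\|\boldsymbol{q}^{\mathrm{Max}}\|_1+2\|\boldsymbol{\epsilon}\|_1\right)\|\boldsymbol{\Gamma}\|_2^2 .$$
   Context: Recommendations and random flows. $\mathcal{T}=\{t^{\min},\dots,T\}$ is a finite set of integer time indices, of interval length $\tau>0$, with $t^{\min}<1\le T$. $\mathcal{S}$ is the set of stations, $\mathcal{L}$ the set of lines, $\mathcal{W}$ the set of origin-destination (OD) pairs $(u,v)$, $\mathcal{R}^{u,v}$ the set of paths of $(u,v)$, $\mathcal{F}$ the set of triplets $(u,v,r)$ with $r\in\mathcal{R}^{u,v}$; all finite. $\mathcal{P}$ is a finite set of passengers, $\mathcal{R}_p$ the path set of $p$, $\mathcal{P}_t^{u,v}\subseteq\mathcal{P}$ the passengers with OD pair $(u,v)$ and departure time $t$ (for which $\mathcal{R}_p=\mathcal{R}^{u,v}$). $\mathcal{X}=\{\boldsymbol{x}:\ x_{p,r}\in\{0,1\},\ \sum_{r\in\mathcal{R}_p}x_{p,r}=1\ \forall p\in\mathcal{P}\}$. $V_p^r$ is a given real utility and $\Psi$ a given weight (hyperparameter). $\pi_{p,r'}^r$ is the given probability that $p$ chooses path $r$ when recommended $r'$; $\mathbb{1}_{p,r'}^r$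 is the Bernoulli indicator of that choice (mean $\pi_{p,r'}^r$; for each $p,r'$ exactly one path is chosen; choices of different passengers are independent). $Q_t^{u,v,r}(\boldsymbol{x})=\sum_{p\in\mathcal{P}_t^{u,v}}\sum_{r'\in\mathcal{R}^{u,v}}x_{p,r'}\mathbb{1}_{p,r'}^r$ and $\boldsymbol{Q}(\boldsymbol{x})=(Q_t^{u,v,r}(\boldsymbol{x}))_{t\in\mathcal{T},(u,v,r)\in\mathcal{F}}$; $\mathcal{Q}(\boldsymbol{x})$ is the finite set of its possible values. $\boldsymbol{\epsilon}=(\epsilon_t^{u,v,r})$ and $\boldsymbol{\Gamma}=(\Gamma_t^{u,v,r})$ are vectors of small positive constants, indexed by $(u,v,r)\in\mathcal{F}$, $t\in\mathcal{T}$; expectation, variance, squares, absolute values and inequalities of vectors are componentwise. $\mathcal{D}(\boldsymbol{x})$ is the set of $\boldsymbol{q}\ge0$ such that for all $(u,v,r)\in\mathcal{F}$, $t\in\mathcal{T}$: $$\left|q_t^{u,v,r}-\sum_{p\in\mathcal{P}_t^{u,v}}\sum_{r'\in\mathcal{R}^{u,v}}x_{p,r'}\pi_{p,r'}^r\right|\le\epsilon_t^{u,v,r},\qquad \sum_{p\in\mathcal{P}_t^{u,v}}\sum_{r'\in\mathcal{R}^{u,v}}x_{p,r'}\pi_{p,r'}^r(1-\pi_{p,r'}^r)\le(\Gamma_t^{u,v,r})^2 .$$ System travel time. $STT(\boldsymbol{q})=\min_{\boldsymbol{z}\in\mathcal{Z}(\boldsymbol{q})}WT(\boldsymbol{q},\boldsymbol{z})+IVT(\boldsymbol{q},\boldsymbol{z})$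 is the value of the following linear program. A path $(u,v,r)$ consists of legs $i\in\mathcal{I}^{u,v,r}=\{1,\dots,|\mathcal{I}^{u,v,r}|\}$, each on one line with a boarding and an alighting station. $\Delta_t^{u,v,r,i}$ (resp. $\delta_t^{u,v,r,i}$) is the travel time from the line's terminal to the boarding (resp. alighting) station of leg $(u,v,r,i)$ for a vehicle departing from the terminal at $t$. $K_{l,t}$ is the capacity of the vehicle departing on line $l$ at $t$, $T_{l,t}$ its arrival time at the last station, $T^{\mathrm{IVT}}_{u,v,r,i,t}$ the in-vehicle time of leg $(u,v,r,i)$ on the vehicle departing at $t$, $d_t^{u,v}$ the total demand, $f_t^{u,v,r}$ the given flow of passengers not receiving recommendations, $\hat z_t^{u,v,r,i}$ given existing onboard flows. $\mathcal{Z}(\boldsymbol{q})$ is the set of $\boldsymbol{z}=(z_t^{u,v,r,i})_{t\in\mathcal{T},(u,v,r)\in\mathcal{F},i\in\mathcal{I}^{u,v,r}}\ge0$ such that: (1) $\sum_{r\in\mathcal{R}^{u,v}}(q_t^{u,v,r}+f_t^{u,v,r})=d_t^{u,v}$ for all $(u,v)\in\mathcal{W}$, $t\in\mathcal{T}$; (2) $z_t^{u,v,r,i}=\hat z_t^{u,v,r,i}$ for all $(u,v,r,i,t)$ with $t+\Delta_t^{u,v,r,i}\le1\le t+\delta_t^{u,v,r,i}$; (3) for all $l\in\mathcal{L}$, $t\in\mathcal{T}$, $t'=t,\dots,T_{l,t}$: $\sum z_t^{u,v,r,i}\le K_{l,t}$, summing over legs $(u,v,r,i)$ on line $l$ with $t+\Delta_t^{u,v,r,i}\le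 t'\le t+\delta_t^{u,v,r,i}$; (4) for all $(u,v,r)\in\mathcal{F}$, $t\in\mathcal{T}$: $\sum_{\{t':\,t^{\min}\le t'+\Delta_{t'}^{u,v,r,1}\le t\}}z_{t'}^{u,v,r,1}\le\sum_{t'=t^{\min}}^{t}(q_{t'}^{u,v,r}+f_{t'}^{u,v,r})$; (5) for all $(u,v,r)\in\mathcal{F}$, $i\in\mathcal{I}^{u,v,r}\setminus\{1\}$, $t\in\mathcal{T}$: $\sum_{\{t':\,t^{\min}\le t'+\Delta_{t'}^{u,v,r,i}\le t\}}z_{t'}^{u,v,r,i}\le\sum_{\{t':\,t^{\min}\le t'+\delta_{t'}^{u,v,r,i-1}\le t\}}z_{t'}^{u,v,r,i-1}$. Moreover $IVT(\boldsymbol{q},\boldsymbol{z})=\sum_{(u,v,r)\in\mathcal{F}}\sum_{i\in\mathcal{I}^{u,v,r}}\sum_{t\in\mathcal{T}}z_t^{u,v,r,i}T^{\mathrm{IVT}}_{u,v,r,i,t}$ and $WT(\boldsymbol{q},\boldsymbol{z})=\sum_{s\in\mathcal{S}}\sum_{t=1}^{T}\left[\tau(AD_{s,t}+XD_{s,t}-BD_{s,t})+\frac{\tau}{2}(BD_{s,t+1}-BD_{s,t})\right]$, where $AD_{s,t}=\sum_{\{(u,v,r)\in\mathcal{F}:\,u=s\}}\sum_{t'=t^{\min}}^{t}(q_{t'}^{u,v,r}+f_{t'}^{u,v,r})$; $XD_{s,t}=\sum_{(u,v,r,i)}\sum_{\{t':\,t^{\min}\le t'+\delta_{t'}^{u,v,r,i-1}\le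 t\}}z_{t'}^{u,v,r,i-1}$, over legs $(u,v,r,i)$, $i\ge2$, that transfer at $s$; $BD_{s,t}=\sum_{(u,v,r,i)}\sum_{\{t':\,t^{\min}\le t'+\Delta_{t'}^{u,v,r,i}\le t\}}z_{t'}^{u,v,r,i}$, over legs with boarding station $s$. ''Set of optimal flows'' means the set of minimizers $\boldsymbol{z}$ of this linear program for the given flow. *)

(* Defs.v *)
From HB Require Import structures.
From mathcomp Require Import all_boot all_order all_algebra.
From mathcomp Require Import all_classical all_reals all_analysis.

Set Implicit Arguments.
Unset Strict Implicit.
Unset Printing Implicit Defensive.

Import Order.TTheory GRing.Theory Num.Theory.

Local Open Scope classical_set_scope.
Local Open Scope ring_scope.

Record horizon := Horizon {
  tmin : int;
  tmax : int;
  tmin_lt1 : tmin < 1;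
  tmax_ge1 : 1 <= tmax }.

(* The index set {tmin, ..., tmax}: the ordinal k stands for the integer
   tmin + k. *)
Definition time (h : horizon) : finType := 'I_(`|tmax h - tmin h|%N.+1).

Definition idx (h : horizon) (t : time h) : int := tmin h + (t : nat)%:Z.

(* A path is a whole triplet (u, v, r); its OD pair (u, v) is [od].  Legs of
   [r] are the naturals 1, ..., nlegs r.  Travel times and arrival times are
   measured in time indices and need not be integers. *)
Record network (R : realType) (h : horizon) := Network {
  station : finType;
  line : finType;
  path : finType;
  ODs : {set station * station};
  od : path -> station * station;
  od_ODs : forall r, od r \in ODs;
  nlegs : path -> nat;
  nlegs_gt0 : forall r, (0 < nlegs r)%N;
  leg_line : path -> nat -> line;
  board : path -> nat -> station;
  tau : R;
  tau_gt0 : 0 < tau;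
  (* Travel times from the line's terminal to the boarding ([Delta]) and to
     the alighting ([delta]) station of a leg, for the vehicle leaving the
     terminal at the given time. *)
  Delta : time h -> path -> nat -> R;
  delta : time h -> path -> nat -> R;
  capacity : line -> time h -> R;
  arrival : line -> time h -> R;
  leg_ivt : path -> nat -> time h -> R;
  demand : time h -> station * station -> R;
  other_flow : time h -> path -> R;
  zhat : time h -> path -> nat -> R }.

Arguments station {R h}. Arguments line {R h}. Arguments path {R h}.
Arguments ODs {R h}. Arguments od {R h}. Arguments nlegs {R h}.
Arguments leg_line {R h}. Arguments board {R h}. Arguments tau {R h}.
Arguments Delta {R h}. Arguments delta {R h}. Arguments capacity {R h}.
Arguments arrival {R h}. Arguments leg_ivt {R h}. Arguments demand {R h}.
Arguments other_flow {R h}. Arguments zhat {R h}.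

Section SystemTravelTime.
Context (R : realType) (h : horizon) (N : network R h).

Definition flow := time h -> path N -> R.

(* Only the entries at legs of a path ([is_leg]) are meaningful. *)
Definition leg_flow := time h -> path N -> nat -> R.

Definition is_leg (r : path N) (i : nat) : bool := (0 < i <= nlegs N r)%N.

Definition dep_board (t : time h) (r : path N) (i : nat) : R :=
  (idx t)%:~R + Delta N t r i.

Definition dep_alight (t : time h) (r : path N) (i : nat) : R :=
  (idx t)%:~R + delta N t r i.

(* Cumulative flows up to an integer time, which may exceed the horizon (the
   waiting time uses tmax + 1). *)
Definition cum_dep (q : flow) (r : path N) (s : int) : R :=
  \sum_(t : time h | idx t <= s) (q t r + other_flow N t r).

Definition cum_board (z : leg_flow) (r : path N) (i : nat) (s : int) : R :=
  \sum_(t : time h | (tmin h)%:~R <= dep_board t r i <= s%:~R) z t r i.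

Definition cum_alight (z : leg_flow) (r : path N) (i : nat) (s : int) : R :=
  \sum_(t : time h | (tmin h)%:~R <= dep_alight t r i <= s%:~R) z t r i.

Record feasible_legs (q : flow) (z : leg_flow) : Prop := FeasibleLegs {
  legs_ge0 : forall t r i, is_leg r i -> 0 <= z t r i;
  legs_demand : forall w t, w \in ODs N ->
    \sum_(r | od N r == w) (q t r + other_flow N t r) = demand N t w;
  legs_onboard : forall t r i, is_leg r i ->
    dep_board t r i <= 1 <= dep_alight t r i -> z t r i = zhat N t r i;
  legs_capacity : forall l (t : time h) (s : int),
    idx t <= s -> s%:~R <= arrival N l t ->
    \sum_(r : path N) \sum_(1 <= i < (nlegs N r).+1 |
        (leg_line N r i == l) && (dep_board t r i <= s%:~R <= dep_alight t r i))
      z t r i <= capacity N l t;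
  legs_first : forall r (t : time h), cum_board z r 1 (idx t) <= cum_dep q r (idx t);
  legs_transfer : forall r i (t : time h), is_leg r i -> (1 < i)%N ->
    cum_board z r i (idx t) <= cum_alight z r i.-1 (idx t) }.

Definition Zset (q : flow) : set leg_flow := [set z | feasible_legs q z].

Definition AD (q : flow) (s : station N) (t : int) : R :=
  \sum_(r | (od N r).1 == s) cum_dep q r t.

(* Leg i >= 2 transfers at the station where it is boarded. *)
Definition XD (z : leg_flow) (s : station N) (t : int) : R :=
  \sum_(r : path N) \sum_(2 <= i < (nlegs N r).+1 | board N r i == s)
    cum_alight z r i.-1 t.

Definition BD (z : leg_flow) (s : station N) (t : int) : R :=
  \sum_(r : path N) \sum_(1 <= i < (nlegs N r).+1 | board N r i == s)
    cum_board z r i t.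

Definition WT (q : flow) (z : leg_flow) : R :=
  \sum_(s : station N) \sum_(t : time h | 1 <= idx t)
    (tau N * (AD q s (idx t) + XD z s (idx t) - BD z s (idx t))
     + tau N / 2 * (BD z s (idx t + 1) - BD z s (idx t))).

Definition IVT (z : leg_flow) : R :=
  \sum_(r : path N) \sum_(1 <= i < (nlegs N r).+1) \sum_(t : time h)
    z t r i * leg_ivt N r i t.

(* Value of the linear program, with the usual conventions +oo when it is
   infeasible and -oo when it is unbounded. *)
Definition STT (q : flow) : \bar R :=
  ereal_inf [set (WT q z + IVT z)%:E | z in Zset q].

Definition optimal_flows (q : flow) : set leg_flow :=
  [set z | Zset q z /\
    forall z', Zset q z' -> WT q z + IVT z <= WT q z' + IVT z'].

Definition bounded_flows (A : set leg_flow) : Prop :=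
  exists M : R, forall z, A z -> forall t r i, is_leg r i -> `|z t r i| <= M.

(* The nonnegative path flows that can be loaded on the network, that is, for
   which the linear program has a feasible solution. *)
Definition network_flow : set flow :=
  [set q | (forall t r, 0 <= q t r) /\ Zset q !=set0].

Definition norm1 (q : flow) : R := \sum_(t : time h) \sum_(r : path N) `|q t r|.

Definition norm2 (q : flow) : R :=
  Num.sqrt (\sum_(t : time h) \sum_(r : path N) q t r ^+ 2).

Definition subf (q1 q2 : flow) : flow := fun t r => q1 t r - q2 t r.

(* [STT] takes extended values; since q1 = q2 is allowed and no infinite value
   satisfies the inequality, this includes finiteness of [STT] at every
   network flow. *)
Definition STT_lipschitz (L : R) : Prop :=
  forall q1 q2, network_flow q1 -> network_flow q2 ->
    (`|STT q1 - STT q2| <= (L * norm1 (subf q1 q2))%:E)%E.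

End SystemTravelTime.

(* [choice_prob p r' r] is the probability that p chooses r when recommended
   r'.  It, like [utility] and the recommendations below, is only meaningful
   at paths of the passenger's OD pair. *)
Record recommendation (R : realType) (h : horizon) (N : network R h) :=
  Recommendation {
  pax : finType;
  pax_od : pax -> station N * station N;
  pax_od_ODs : forall p, pax_od p \in ODs N;
  pax_time : pax -> time h;
  utility : pax -> path N -> R;
  weight : R;
  choice_prob : pax -> path N -> path N -> R;
  eps : flow N;
  eps_gt0 : forall t r, 0 < eps t r;
  Gamma : flow N;
  Gamma_gt0 : forall t r, 0 < Gamma t r }.

Arguments pax {R h N}. Arguments pax_od {R h N}. Arguments pax_time {R h N}.
Arguments utility {R h N}. Arguments weight {R h N}.
Arguments choice_prob {R h N}. Arguments eps {R h N}. Arguments Gamma {R h N}.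

Section Recommendation.
Context (R : realType) (h : horizon) (N : network R h) (C : recommendation N).

Definition assignment := pax C -> path N -> R.

(* r is in R_p *)
Definition has_path (p : pax C) : pred (path N) :=
  fun r => od N r == pax_od C p.

(* p is in P_t^{u,v}, for (u, v) the OD pair of r *)
Definition pax_at (t : time h) (r : path N) : pred (pax C) :=
  fun p => (pax_od C p == od N r) && (pax_time C p == t).

Definition Xset : set assignment :=
  [set x | (forall p r, has_path p r -> x p r = 0 \/ x p r = 1) /\
           forall p, \sum_(r | has_path p r) x p r = 1].

Definition Dset (x : assignment) : set (flow N) :=
  [set q | [/\ forall t r, 0 <= q t r,
    forall t r,
      `|q t r - \sum_(p | pax_at t r p) \sum_(r' | od N r' == od N r)
                  x p r' * choice_prob C p r' r| <= eps C t r
    & forall t r,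
      \sum_(p | pax_at t r p) \sum_(r' | od N r' == od N r)
        x p r' * choice_prob C p r' r * (1 - choice_prob C p r' r)
      <= Gamma C t r ^+ 2]].

Definition AIPRP_feasible (x : assignment) (q : flow N) (z : leg_flow N) :=
  [/\ Xset x, Dset x q & Zset q z].

Definition AIPRP_objective (x : assignment) (q : flow N) (z : leg_flow N) : R :=
  - weight C * (\sum_p \sum_(r | has_path p r) x p r * utility C p r)
  + WT q z + IVT z.

Definition AIPRP_optimal (x : assignment) (q : flow N) (z : leg_flow N) :=
  AIPRP_feasible x q z /\
  forall x' q' z', AIPRP_feasible x' q' z' ->
    AIPRP_objective x q z <= AIPRP_objective x' q' z'.

End Recommendation.

(* Mutual independence of a finite family of classes of events. *)
Definition mutually_independent d (Omega : measurableType d) (R : realType)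
    (P : probability Omega R) (I : finType) (G : I -> set (set Omega)) : Prop :=
  forall (J : {set I}) (A : I -> set Omega),
    (forall i, i \in J -> G i (A i)) ->
    P (\bigcap_(i in [set i | i \in J]) A i) = (\prod_(i in J) P (A i))%E.

(* [ind p r' r] is the indicator of the choice of r by p when recommended r'.
   Independence bears on the sigma-algebras generated by all the indicators of
   each passenger; nothing is assumed on the joint law of the choices of one
   passenger under different recommendations. *)
Record choice_model (R : realType) (h : horizon) (N : network R h)
    (C : recommendation N) d (Omega : measurableType d)
    (P : probability Omega R) := ChoiceModel {
  ind : pax C -> path N -> path N -> {RV P >-> R};
  ind01 : forall p r' r w, has_path p r' -> has_path p r ->
    ind p r' r w = 0 \/ ind p r' r w = 1;
  ind_mean : forall p r' r, has_path p r' -> has_path p r ->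
    ('E_P[ind p r' r] = (choice_prob C p r' r)%:E)%E;
  ind_one : forall p r' w, has_path p r' ->
    \sum_(r | has_path p r) ind p r' r w = 1;
  ind_indep : mutually_independent P (fun p =>
    <<s [set A | exists r' r, [/\ has_path p r', has_path p r
                                & A = ind p r' r @^-1` [set 1]]] >>) }.

Section RandomFlow.
Context (R : realType) (h : horizon) (N : network R h) (C : recommendation N).
Context d (Omega : measurableType d) (P : probability Omega R).
Context (M : choice_model C P).

Definition random_flow (x : assignment C) (t : time h) (r : path N)
    (w : Omega) : R :=
  \sum_(p | pax_at t r p) \sum_(r' | od N r' == od N r) x p r' * ind M p r' r w.

Definition realized_flow (x : assignment C) (w : Omega) : flow N :=
  fun t r => random_flow x t r w.

(* The law of the flow is discrete: its support is the set of its atoms. *)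
Definition flow_support (x : assignment C) : set (flow N) :=
  [set q | (0 < P [set w | realized_flow x w = q])%E].

Definition mean_flow (x : assignment C) : flow N :=
  fun t r => fine ('E_P[random_flow x t r])%E.

(* Written with the integral because [STT] is extended-real valued. *)
Definition expected_STT (x : assignment C) : \bar R :=
  (\int[P]_w STT (realized_flow x w))%E.

End RandomFlow.

(* Main.v *)
Require Import Defs.
From mathcomp Require Import all_boot all_order all_algebra.
From mathcomp Require Import all_classical all_reals all_analysis.
From mathcomp Require Import measurable_realfun.
From mathcomp Require Import ring lra.

Set Implicit Arguments.
Unset Strict Implicit.
Unset Printing Implicit Defensive.

Import Order.TTheory GRing.Theory Num.Theory.

Local Open Scope classical_set_scope.
Local Open Scope ring_scope.

(** Write [Q] for the random flow under [xs], [m] for its mean and [n] for the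
    number of passengers.  Almost surely [Q] lies in the support, hence is a
    network flow, and the Lipschitz hypothesis gives
      [|E(STT Q) - STT qs| <= L * E(norm1 (Q - qs))
                           <= L * (norm1 eps + sum_(t, r) E|Q t r - m t r|)].

    The last sum is controlled without Chebyshev's inequality.  Each [Q t r] is
    a nonnegative combination of Bernoulli variables, and a Bernoulli variable
    of mean [a] has mean absolute deviation [2 * a * (1 - a)], twice its
    variance ([bernoulli_deviation]).  By the triangle inequality [E|Q t r -
    m t r|] is at most twice the sum that the variance constraint of [Dset]
    bounds by [Gamma t r ^+ 2] ([mean_flow_deviation]).

    It remains to compare the resulting [2 * norm2 Gamma ^+ 2] with the stated
    bound.  Every passenger takes exactly one path, so the entries of [Q] always
    add up to [n] ([total_flow]); therefore [n <= norm1 m] and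
    [n <= norm1 qMax].  Either [n = 0], and [Q] does not deviate at all, or
    [2 <= 2 * n <= norm1 m + norm1 qMax].

    The choices of all passengers form a random element of a finite type, so
    every expectation is a finite weighted sum ([integral_law]), and the
    infinite values that [STT] may take off the support have weight zero. *)

(** * Random elements of a finite type *)

Section FiniteRandomElement.
Context (R : realType) (d : measure_display) (Omega : measurableType d)
  (P : probability Omega R) (T : finType) (X : Omega -> T).
Context (mX : forall v, measurable (X @^-1` [set v])).

Definition law (v : T) : R := fine (P (X @^-1` [set v])).

Definition mean (F : T -> R) : R := \sum_v F v * law v.

Lemma preimage_measurable (A : set T) : measurable (X @^-1` A).
Proof.
rewrite (_ : X @^-1` A = \bigcup_(v in A) (X @^-1` [set v])).
  by apply: fin_bigcup_measurable => // v _; exact: mX.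
by apply/seteqP; split=> [w Aw|w [v Av /= ->]] //; exists (X w).
Qed.

Lemma lawE v : P (X @^-1` [set v]) = (law v)%:E.
Proof. by rewrite /law fineK // fin_num_measure. Qed.

Lemma law_ge0 v : 0 <= law v.
Proof. by rewrite fine_ge0 // measure_ge0. Qed.

Lemma measurable_fun_finite_comp (g : T -> \bar R) : measurable_fun setT (g \o X).
Proof.
move=> _ Y _; rewrite setTI comp_preimage; exact: preimage_measurable.
Qed.

Lemma ge0_integral_law (g : T -> \bar R) : (forall v, 0 <= g v)%E ->
  (\int[P]_w g (X w) = \sum_v g v * (law v)%:E)%E.
Proof.
move=> g0.
transitivity
  (\int[P]_w (\sum_(v : T) (g v * (\1_(X @^-1` [set v]) w)%:E)))%E.
  apply: eq_integral => w _.
  rewrite (bigD1 (X w)) //= big1 => [|v vX].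
    by rewrite adde0 indicE mem_set // mule1.
  by rewrite indicE memNset ?mule0 //= => wv; rewrite wv eqxx in vX.
rewrite ge0_integral_sum //.
- apply: eq_bigr => v _; rewrite -lawE.
  rewrite ge0_integralZl // ?integral_indic ?setIT //.
  by apply/measurable_EFinP; exact: measurable_indic.
- move=> v; rewrite (_ : (fun w => _) =
    (fun u => g v * (v == u)%:R%:E)%E \o X); first exact: measurable_fun_finite_comp.
  apply/funext => w /=; rewrite indicE; congr (_ * _%:R%:E)%E; congr nat_of_bool.
  by apply/idP/eqP => [/set_mem /= ->|->] //; exact/mem_set.
- by move=> v w _; rewrite mule_ge0 // lee_fin.
Qed.

(** The integrand may be infinite on null fibres, where the convention
    [0 * +oo = 0] discards its value. *)
Lemma integral_law (g : T -> \bar R) :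
  (forall v, 0 < law v -> g v \is a fin_num) ->
  (\int[P]_w g (X w) = (mean (fine \o g))%:E)%E.
Proof.
move=> gfin.
(* [e] stands for the positive or the negative part, [e'] for its restriction
   to finite values. *)
have part (e : \bar R -> \bar R) (e' : R -> R) : (forall x, 0 <= e x)%E ->
    (forall x, e x%:E = (e' x)%:E) ->
    (\int[P]_w e (g (X w)) = (mean (e' \o fine \o g))%:E)%E.
  move=> e0 ee'; rewrite (ge0_integral_law (g := e \o g)) => [|v]; last exact: e0.
  rewrite /mean -sumEFin; apply: eq_bigr => v _ /=.
  have := law_ge0 v; rewrite le_eqVlt => /predU1P[<-|/gfin/fineK gv].
    by rewrite mule0 mulr0.
  by rewrite -{1}gv ee'.
rewrite integralE.
rewrite (_ : (g \o X)^\+ = fun w => maxe (g (X w)) 0)%E; last first.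
  by apply/funext=> w; rewrite funeposE.
rewrite (_ : (g \o X)^\- = fun w => maxe (- g (X w)) 0)%E; last first.
  by apply/funext=> w; rewrite funenegE.
rewrite (part (fun y => maxe y 0)%E (fun y => Num.max y 0)); first last.
- by move=> y; rewrite EFin_max.
- by move=> y; rewrite le_max lexx orbT.
rewrite (part (fun y => maxe (- y) 0)%E (fun y => Num.max (- y) 0)); first last.
- by move=> y; rewrite EFin_max EFinN.
- by move=> y; rewrite le_max lexx orbT.
rewrite -EFinB; congr EFin; rewrite /mean -sumrB; apply: eq_bigr => v _ /=.
rewrite -mulrBl; congr (_ * _).
by case: (lerP (fine (g v)) 0); case: (lerP (- fine (g v)) 0); lra.
Qed.

Lemma expectation_law (F : T -> R) : ('E_P[fun w => F (X w)] = (mean F)%:E)%E.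
Proof. by rewrite unlock; exact: (integral_law (g := EFin \o F)). Qed.

Lemma sum_law : \sum_v law v = 1.
Proof.
apply: EFin_inj; rewrite -(@probability_setT _ _ _ P) -[RHS]mul1e.
rewrite -integral_cst // (integral_law (g := cst 1%E)) //.
by congr EFin; apply: eq_bigr => v _; rewrite mul1r.
Qed.

Lemma mean_cst c : mean (fun=> c) = c.
Proof. by rewrite /mean -mulr_sumr sum_law mulr1. Qed.

Lemma meanD F G : mean (fun v => F v + G v) = mean F + mean G.
Proof. by rewrite /mean -big_split; apply: eq_bigr => v _; rewrite mulrDl. Qed.

Lemma meanZ c F : mean (fun v => c * F v) = c * mean F.
Proof. by rewrite /mean mulr_sumr; apply: eq_bigr => v _; rewrite mulrA. Qed.

Lemma meanB F G : mean (fun v => F v - G v) = mean F - mean G.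
Proof. by rewrite /mean -sumrB; apply: eq_bigr => v _; rewrite mulrBl. Qed.

Lemma mean_sum (I : finType) (A : pred I) (F : I -> T -> R) :
  mean (fun v => \sum_(i | A i) F i v) = \sum_(i | A i) mean (F i).
Proof.
by rewrite /mean exchange_big; apply: eq_bigr => v _; rewrite mulr_suml.
Qed.

Lemma le_mean F G : (forall v, 0 < law v -> F v <= G v) -> mean F <= mean G.
Proof.
move=> FG; apply: ler_sum => v _.
have := law_ge0 v; rewrite le_eqVlt => /predU1P[<-|v0]; first by rewrite !mulr0.
by rewrite ler_wpM2r ?law_ge0 ?FG.
Qed.

Lemma ler_norm_mean F : `|mean F| <= mean (fun v => `|F v|).
Proof.
apply: le_trans (ler_norm_sum _ _ _) _; apply: ler_sum => v _.
by rewrite normrM (ger0_norm (law_ge0 v)).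
Qed.

Lemma law_gt0_exists : exists v, 0 < law v.
Proof.
apply: contrapT => /forallNP law0; have := sum_law; rewrite big1 => [/eqP|v _].
  by rewrite eq_sym oner_eq0.
by apply/le_anti; rewrite law_ge0 andbT leNgt; exact/negP.
Qed.

Lemma law_gt0_image v : 0 < law v -> exists w, X w = v.
Proof.
move=> v0; apply: contrapT => /forallNP Xv; move: v0.
rewrite /law (_ : _ @^-1` _ = set0) ?measure0 ?ltxx //.
by apply/seteqP; split=> [w /= /Xv|].
Qed.

(** The mean absolute deviation of a Bernoulli variable is twice its variance,
    with no square root: this is what makes a bound linear in the variance
    possible. *)
Lemma bernoulli_deviation (B : T -> bool) (a : R) :
  mean (fun v => (B v)%:R) = a ->
  mean (fun v => `|(B v)%:R - a|) = 2 * (a * (1 - a)).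
Proof.
move=> Ba.
have a0 : 0 <= a.
  by rewrite -Ba -(mean_cst 0); apply: le_mean => v _.
have a1 : a <= 1.
  by rewrite -Ba -[leRHS](mean_cst 1); apply: le_mean => v _; case: (B v).
transitivity (mean (fun v => (1 - 2 * a) * (B v)%:R + a)).
  apply: eq_bigr => v _; congr (_ * _).
  by case: (B v) => /=; [rewrite ger0_norm|rewrite ler0_norm]; lra.
by rewrite meanD meanZ mean_cst Ba; ring.
Qed.

End FiniteRandomElement.

(** * Choice patterns and the path flows they induce *)

Section ChoicePattern.
Context (R : realType) (h : horizon) (N : network R h) (C : recommendation N)
  (d : measure_display) (Omega : measurableType d) (P : probability Omega R)
  (M : choice_model C P).

(** Keys are [(p, r', r)], in the order of the arguments of [ind].  Every random
    flow is a function of the pattern, which makes its law finite although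
    [Omega] is arbitrary. *)
Definition pattern := {ffun pax C * Defs.path N * Defs.path N -> bool}.

Definition choice_pattern (w : Omega) : pattern :=
  [ffun k => ind M k.1.1 k.1.2 k.2 w == 1].

Definition pattern_flow (x : assignment C) (v : pattern) : flow N :=
  fun t r => \sum_(p | pax_at t r p) \sum_(r' | od N r' == od N r)
    x p r' * (v (p, r', r))%:R.

Local Notation mean := (mean P choice_pattern).
Local Notation law := (law P choice_pattern).

Lemma choice_pattern_measurable v : measurable (choice_pattern @^-1` [set v]).
Proof.
rewrite (_ : _ @^-1` _ = \bigcap_(k in [set: pax C * Defs.path N * Defs.path N])
    (ind M k.1.1 k.1.2 k.2 @^-1` [set y | (y == 1) = v k])).
  apply: fin_bigcap_measurable => // k _.
  rewrite -[X in measurable X]setTI; apply: measurable_funPT => //.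
  case: (v k).
    by rewrite (_ : [set _ | _] = [set 1]) //; apply/seteqP; split=> y /eqP.
  rewrite (_ : [set _ | _] = ~` [set 1]); first exact: measurableC.
  by apply/seteqP; split=> y /= /eqP; [|move/negbTE].
apply/seteqP; split=> [w /= <- k _ /=|w vw]; first by rewrite ffunE.
by apply/ffunP => k; rewrite ffunE (vw k).
Qed.
Let mX := choice_pattern_measurable.

Lemma pax_at_has_path t r p r' : pax_at (C := C) t r p ->
  (od N r' == od N r) = has_path p r'.
Proof. by move=> /andP[/eqP pr _]; rewrite /has_path pr. Qed.

Lemma pax_at_has_path_self t r p : pax_at (C := C) t r p -> has_path p r.
Proof. by move=> tr; rewrite -(pax_at_has_path _ tr). Qed.

Lemma ind_patternE p r' r w : has_path p r' -> has_path p r ->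
  ind M p r' r w = (choice_pattern w (p, r', r))%:R.
Proof.
move=> pr' pr; rewrite ffunE /=.
by case: (ind01 M w pr' pr) => ->; rewrite ?eqxx // eq_sym oner_eq0.
Qed.

Lemma random_flowE x t r w :
  random_flow M x t r w = pattern_flow x (choice_pattern w) t r.
Proof.
apply: eq_bigr => p tr; apply: eq_bigr => r'; rewrite (pax_at_has_path _ tr).
by move=> pr'; rewrite ind_patternE //; exact: pax_at_has_path_self tr.
Qed.

Lemma realized_flowE x w : realized_flow M x w = pattern_flow x (choice_pattern w).
Proof. by apply/funext => t; apply/funext => r; exact: random_flowE. Qed.

Lemma mean_choice p r' r : has_path p r' -> has_path p r ->
  mean (fun v => (v (p, r', r))%:R) = choice_prob C p r' r.
Proof.
move=> pr' pr; apply: EFin_inj; rewrite -(ind_mean M pr' pr) -expectation_law //.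
by congr ('E_P[_])%E; apply/funext => w; rewrite ind_patternE.
Qed.

Lemma mean_flowE x t r : mean_flow M x t r = mean (fun v => pattern_flow x v t r).
Proof.
rewrite /mean_flow (_ : random_flow M x t r =
  fun w => pattern_flow x (choice_pattern w) t r).
  by rewrite (expectation_law P mX (fun v => pattern_flow x v t r)).
by apply/funext => w; exact: random_flowE.
Qed.

Lemma mean_flow_choice_prob x t r : mean_flow M x t r =
  \sum_(p | pax_at t r p) \sum_(r' | od N r' == od N r)
    x p r' * choice_prob C p r' r.
Proof.
rewrite mean_flowE mean_sum; apply: eq_bigr => p tr.
rewrite mean_sum; apply: eq_bigr => r'; rewrite (pax_at_has_path _ tr) => pr'.
by rewrite meanZ mean_choice //; exact: pax_at_has_path_self tr.
Qed.

(** The flow is a weighted sum of Bernoulli variables, so the triangle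
    inequality reduces the claim to [bernoulli_deviation]; the sum on the right
    is the one that the variance constraint of [Dset] bounds. *)
Lemma mean_flow_deviation x t r :
  (forall p r', has_path p r' -> 0 <= x p r') ->
  mean (fun v => `|pattern_flow x v t r - mean_flow M x t r|) <=
  2 * \sum_(p | pax_at t r p) \sum_(r' | od N r' == od N r)
        x p r' * choice_prob C p r' r * (1 - choice_prob C p r' r).
Proof.
move=> x0.
apply: (@le_trans _ _ (mean (fun v =>
    \sum_(p | pax_at t r p) \sum_(r' | od N r' == od N r)
      x p r' * `|(v (p, r', r))%:R - choice_prob C p r' r|))).
  apply: le_mean => v _; rewrite mean_flow_choice_prob -sumrB.
  apply: le_trans (ler_norm_sum _ _ _) _; apply: ler_sum => p tr.
  rewrite -sumrB; apply: le_trans (ler_norm_sum _ _ _) _.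
  apply: ler_sum => r'; rewrite (pax_at_has_path _ tr) => pr'.
  by rewrite -mulrBr normrM ger0_norm // x0.
rewrite mean_sum mulr_sumr; apply: ler_sum => p tr.
rewrite mean_sum mulr_sumr; apply: ler_sum => r'.
rewrite (pax_at_has_path _ tr) => pr'; have pr := pax_at_has_path_self tr.
rewrite meanZ (bernoulli_deviation mX (B := fun v : pattern => v (p, r', r))
  (mean_choice pr' pr)) //.
by rewrite le_eqVlt; apply/orP; left; apply/eqP; ring.
Qed.

(** For a fixed passenger the double sum over the path taken and the path
    recommended collapses, by [ind_one] and then by the constraint of [Xset]. *)
Lemma total_flow x w : Xset x ->
  \sum_t \sum_r realized_flow M x w t r = #|pax C|%:R.
Proof.
move=> [_ x1].
under eq_bigr do under eq_bigr do rewrite /realized_flow /random_flow big_mkcond.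
under eq_bigr do rewrite exchange_big.
rewrite exchange_big -sum1_card natr_sum; apply: eq_bigr => p _ /=.
rewrite (bigD1 (pax_time C p)) //= [X in _ + X]big1 => [|t tp]; last first.
  by rewrite big1 // => r _; rewrite /pax_at [_ == t]eq_sym (negbTE tp) andbF.
rewrite addr0 -big_mkcond /=.
under eq_bigl do rewrite /pax_at eqxx andbT eq_sym.
rewrite -[RHS](x1 p).
transitivity (\sum_(r | has_path p r) \sum_(r' | has_path p r')
    x p r' * ind M p r' r w).
  by apply: eq_bigr => r /eqP ->.
rewrite exchange_big; apply: eq_bigr => r' pr'.
by rewrite -mulr_sumr ind_one // mulr1.
Qed.

Lemma pattern_flow_support x v : 0 < law v -> flow_support M x (pattern_flow x v).
Proof.
move=> v0; rewrite /flow_support /=.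
apply: (@lt_le_trans _ _ (P (choice_pattern @^-1` [set v]))).
  by rewrite lawE // lte_fin.
apply: le_measure; rewrite ?inE //.
- rewrite (_ : mkset _ = choice_pattern @^-1`
      [set u | pattern_flow x u = pattern_flow x v]).
    exact: preimage_measurable.
  by apply/seteqP; split=> w /=; rewrite realized_flowE.
- by move=> w /= <-; rewrite realized_flowE.
Qed.

Lemma expected_STT_law x :
  (forall v, 0 < law v -> STT (pattern_flow x v) \is a fin_num) ->
  expected_STT M x = (mean (fun v => fine (STT (pattern_flow x v))))%:E.
Proof.
move=> /(integral_law mX (g := fun v => STT (pattern_flow x v))) <-.
by apply: eq_integral => w _; rewrite realized_flowE.
Qed.

(** * Mean deviation of the random flow *)

(** The factor [#|pax C|] only weakens the bound when there are passengers, and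
    makes it vanish, as the deviation does, when there are none: the two cases
    need no further distinction. *)
Lemma mean_flow_deviation_Gamma x q t r : Xset x -> Dset x q ->
  mean (fun v => `|pattern_flow x v t r - mean_flow M x t r|) <=
  2 * #|pax C|%:R * Gamma C t r ^+ 2.
Proof.
move=> [x01 _] [_ _ varG].
apply: le_trans (mean_flow_deviation _ _ _) _.
  by move=> p r' /x01[] ->.
rewrite -mulrA ler_wpM2l //; have [pax0|pax_gt0] := posnP #|pax C|.
  by rewrite pax0 mul0r big1 // => p; have := max_card (pred1 p);
     rewrite card1 pax0.
apply: le_trans (varG t r) _.
by rewrite ler_peMl ?sqr_ge0 // ler1n.
Qed.

(** The total flow is constant by [total_flow], hence equal to its mean. *)
Lemma pax_le_norm1_mean_flow x : Xset x -> #|pax C|%:R <= norm1 (mean_flow M x).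
Proof.
move=> Xx; apply: (@le_trans _ _ (\sum_t \sum_r mean_flow M x t r)).
  under eq_bigr do under eq_bigr do rewrite mean_flowE.
  under eq_bigr do rewrite -mean_sum.
  rewrite -mean_sum -[leLHS](mean_cst P mX); apply: le_mean => // v v0.
  have [w <-] := law_gt0_image v0.
  by rewrite -(total_flow w Xx) realized_flowE.
by apply: ler_sum => t _; apply: ler_sum => r _; exact: ler_norm.
Qed.

Lemma pax_le_norm1_support_bound x (qMax : flow N) : Xset x ->
  (forall q, flow_support M x q -> forall t r, q t r <= qMax t r) ->
  #|pax C|%:R <= norm1 qMax.
Proof.
move=> Xx le_qMax; have [v v0] := law_gt0_exists P mX.
have [w wv] := law_gt0_image v0.
rewrite -(total_flow w Xx) realized_flowE wv.
apply: ler_sum => t _; apply: ler_sum => r _.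
apply: le_trans (ler_norm _).
by apply: le_qMax; exact: pattern_flow_support.
Qed.

Lemma mean_norm1_dist x q : Xset x -> Dset x q ->
  (forall t r, `|q t r - mean_flow M x t r| <= eps C t r) ->
  mean (fun v => norm1 (subf (pattern_flow x v) q)) <=
  norm1 (eps C) + 2 * #|pax C|%:R * norm2 (Gamma C) ^+ 2.
Proof.
move=> Xx Dxq close.
rewrite /norm2 sqr_sqrtr; last first.
  by apply: sumr_ge0 => t _; apply: sumr_ge0 => r _; exact: sqr_ge0.
rewrite mean_sum mulr_sumr -big_split; apply: ler_sum => t _ /=.
rewrite mean_sum mulr_sumr -big_split; apply: ler_sum => r _ /=.
apply: le_trans (lerD (ler_norm _) (mean_flow_deviation_Gamma t r Xx Dxq)).
apply: le_trans (lerD (close t r) (lexx _)).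
rewrite -[X in X + _](mean_cst P mX) -meanD; apply: le_mean => // v _.
rewrite [leRHS]addrC (distrC (q t r)); exact: ler_distD.
Qed.

End ChoicePattern.


(** * The bound on the expected system travel time *)

(** At [q1 = q2] the Lipschitz inequality bounds [|STT q - STT q|] by a real
    number, which fails when [STT q] is infinite. *)
Lemma STT_fin_num (R : realType) (h : horizon) (N : network R h) (L : R)
  (q : flow N) : STT_lipschitz N L -> network_flow q -> STT q \is a fin_num.
Proof. by move=> lip qN; have := lip q q qN qN; case: (STT q). Qed.

Theorem proposition2 (R : realType) (h : horizon) (N : network R h)
    (C : recommendation N)
    (d : measure_display) (Omega : measurableType d) (P : probability Omega R)
    (M : choice_model C P)
    (qs : flow N) (zs : leg_flow N) (xs : assignment C)
    (opt : AIPRP_optimal xs qs zs)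
    (bounded_opt : forall q : flow N,
       network_flow q -> bounded_flows (optimal_flows q))
    (L : R) (L_ge0 : 0 <= L) (lip : STT_lipschitz N L)
    (support_flow : forall q, flow_support M xs q -> network_flow q)
    (qMax : flow N)
    (support_le : forall q, flow_support M xs q -> forall t r, q t r <= qMax t r)
    (mean_close : forall t r, `|qs t r - mean_flow M xs t r| <= eps C t r)
    (var_small : forall t r,
       ('V_P[random_flow M xs t r] <= (Gamma C t r ^+ 2)%:E)%E) :
  (`|expected_STT M xs - STT qs| <=
    (2 * L * norm1 (eps C)
     + L * (norm1 (mean_flow M xs) + norm1 qMax + 2 * norm1 (eps C))
         * norm2 (Gamma C) ^+ 2)%:E)%E.
Proof.
have [[Xx Dxq Zqz] _] := opt.
have mX := choice_pattern_measurable M.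
have qs_flow : network_flow qs by split; [case: Dxq|exists zs].
have pattern_network v : 0 < law P (choice_pattern M) v ->
    network_flow (pattern_flow xs v).
  by move=> v0; apply: support_flow; exact: pattern_flow_support.
have qs_fin := STT_fin_num lip qs_flow.
rewrite expected_STT_law => [|v /pattern_network /(STT_fin_num lip) //].
rewrite -(fineK qs_fin) -EFinB abse_EFin lee_fin.
rewrite -[X in _ - X](mean_cst P mX) -meanB.
apply: le_trans (ler_norm_mean _ _ _) _.
apply: (@le_trans _ _ (mean P (choice_pattern M)
    (fun v => L * norm1 (subf (pattern_flow xs v) qs)))).
  apply: le_mean => // v /pattern_network vN.
  have := lip _ _ vN qs_flow; rewrite -lee_fin.
  by rewrite -{1}(fineK qs_fin) -{1}(fineK (STT_fin_num lip vN)) -EFinB abse_EFin.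
rewrite meanZ.
have := ler_wpM2l L_ge0 (mean_norm1_dist Xx Dxq mean_close).
have eps0 : 0 <= norm1 (eps C).
  by apply: sumr_ge0 => t _; apply: sumr_ge0 => r _; exact: normr_ge0.
have pax_le : 2 * #|pax C|%:R <=
    norm1 (mean_flow M xs) + norm1 qMax + 2 * norm1 (eps C).
  have := pax_le_norm1_mean_flow M Xx.
  by have := pax_le_norm1_support_bound Xx support_le; lra.
have Leps0 := mulr_ge0 L_ge0 eps0.
have := ler_wpM2l L_ge0 (ler_wpM2r (sqr_ge0 (norm2 (Gamma C))) pax_le).
rewrite mulrDr -[L * (_ + _) * _]mulrA.
lra.
Qed.
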